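(* (Quantum Nash Equilibrium Theorem.) Every static quantum game, as defined in the context, has at least one Nash equilibrium: there exists a profile $\vec{\chi}=(\chi^1,\dots,\chi^N)\in\Omega_1\times\cdots\times\Omega_N$ such that for every player $k$ and every $\chi'\in\Omega_k$, $P_k(\vec{\chi}_{-k},\chi^k)\ge P_k(\vec{\chi}_{-k},\chi')$.
   Context: A static quantum game is defined as follows. There are $N$ players; each player receives $q$ qubits, and $n=2^q$. A referee prepares an initial state $\rho$, a density matrix on $(\mathbb{C}^n)^{\otimes N}$, sends the $k$-th $q$-qubit subsystem to player $k$; each player applies a trace-preserving completely positive map to their subsystem and returns it; the referee then measures with a POVM $\{M_m\}_{m=1}^L$ and awards player $k$ the amount $a^k_m\in\mathbb{R}$ on outcome $m$. Set $R^k=\sum_{m=1}^L a^k_m M_m^\dagger M_m$; player $k$'s payoff is $\mathrm{tr}(R^k\pi)$, where $\pi$ is the final state. Fix a basis $\{\tilde E_\alpha\}_{\alpha=1}^{4^q}$ of the space of $n\times n$ complex matrices. A trace-preserving completely positive map with Kraus operators $E_j=\sum_\alpha e_{j\alpha}\tilde E_\alpha$ is represented by its chi matrix $\chi_{\alpha\beta}=\sum_j e_{j\alpha}\overline{e_{j\beta}}$. Player $k$'s strategy set $\Omega_k$ is the set of all $4^q\times 4^q$ positive semidefinite Hermitian matrices $\chi$ satisfying $\sum_{\alpha,\beta}\overline{\chi_{\alpha\beta}}\,\tilde E_\alpha^\dagger\tilde E_\beta=I$ (i.e. chi matrices of all trace-preserving completely positive maps). For a profile $\vec\chi=(\chi^1,\dots,\chi^N)$,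 the payoff of player $k$ is $P_k(\vec\chi)=\sum \chi^1_{\alpha_1\beta_1}\cdots\chi^N_{\alpha_N\beta_N}A^k_{\alpha_1\beta_1\cdots\alpha_N\beta_N}$ (sum over all indices), where $A^k_{\alpha_1\beta_1\cdots\alpha_N\beta_N}=\mathrm{tr}\big[R^k(\tilde E_{\alpha_1}\otimes\cdots\otimes\tilde E_{\alpha_N})\rho(\tilde E_{\beta_1}^\dagger\otimes\cdots\otimes\tilde E_{\beta_N}^\dagger)\big]$; this equals $\mathrm{tr}(R^k\pi)$ and is real. Notation: $\vec\chi_{-k}$ denotes the profile with the $k$-th entry removed, and $(\vec\chi_{-k},\chi')$ the profile with the $k$-th entry replaced by $\chi'$. *)

(* Defs.v *)
From HB Require Import structures.
From mathcomp Require Import all_boot all_order all_algebra.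
From mathcomp Require Import reals.
From mathcomp.real_closed Require Import complex.

Set Implicit Arguments.
Unset Strict Implicit.
Unset Printing Implicit Defensive.

Import Order.TTheory GRing.Theory Num.Theory.
Local Open Scope ring_scope.

Section QuantumGame.
Variable R : realType.
Local Notation C := (R[i]).

Definition dag (m p : nat) (A : 'M[C]_(m, p)) : 'M[C]_(p, m) :=
  (map_mx Num.conj A)^T.

Definition psd (m : nat) (X : 'M[C]_m) : Prop :=
  dag X = X /\ forall v : 'cV[C]_m, 0 <= (dag v *m X *m v) 0 0.

Definition density (m : nat) (rho : 'M[C]_m) : Prop :=
  psd rho /\ \tr rho = 1.

(* index set of the composite space (C^n)^{(x) N}: functions 'I_N -> 'I_n,
   i.e. the product basis |i_1 ... i_N>; its cardinality is n^N. *)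
Definition cdim (N n : nat) : nat := #|{: {ffun 'I_N -> 'I_n}}|.

(* Kronecker (tensor) product F_1 (x) ... (x) F_N of n x n matrices,
   in the product basis of the composite space *)
Definition tens (N n : nat) (F : 'I_N -> 'M[C]_n) : 'M[C]_(cdim N n) :=
  \matrix_(i, j) \prod_(k < N)
     F k ((enum_val i : {ffun 'I_N -> 'I_n}) k)
         ((enum_val j : {ffun 'I_N -> 'I_n}) k).

Definition is_basis (d n : nat) (E : 'I_d -> 'M[C]_n) : Prop :=
  (forall c : 'I_d -> C, \sum_(a < d) c a *: E a = 0 -> forall a, c a = 0) /\
  (forall A : 'M[C]_n, exists c : 'I_d -> C, A = \sum_(a < d) c a *: E a).

(* strategy set Omega: chi matrices of all trace-preserving CP maps *)
Definition Omega (d n : nat) (E : 'I_d -> 'M[C]_n) (chi : 'M[C]_d) : Prop :=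
  psd chi /\
  \sum_(a < d) \sum_(b < d) (chi a b)^* *: (dag (E a) *m E b) = 1%:M.

Definition povm (D L : nat) (M : 'I_L -> 'M[C]_D) : Prop :=
  \sum_(m < L) dag (M m) *m M m = 1%:M.

Definition Rop (D L : nat) (M : 'I_L -> 'M[C]_D) (ak : 'I_L -> R) : 'M[C]_D :=
  \sum_(m < L) (ak m)%:C%C *: (dag (M m) *m M m).

Definition Acoef (N d n : nat) (E : 'I_d -> 'M[C]_n)
  (rho Rk : 'M[C]_(cdim N n)) (al be : {ffun 'I_N -> 'I_d}) : C :=
  \tr (Rk *m tens (fun k => E (al k)) *m rho *m tens (fun k => dag (E (be k)))).

Definition payoff (N d n : nat) (E : 'I_d -> 'M[C]_n)
  (rho Rk : 'M[C]_(cdim N n)) (chi : 'I_N -> 'M[C]_d) : C :=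
  \sum_(al : {ffun 'I_N -> 'I_d}) \sum_(be : {ffun 'I_N -> 'I_d})
     (\prod_(k < N) chi k (al k) (be k)) * Acoef E rho Rk al be.

End QuantumGame.

Definition upd (T : Type) (N : nat) (chi : 'I_N -> T) (k : 'I_N) (chi' : T)
  : 'I_N -> T := fun j => if j == k then chi' else chi j.

(* Main.v *)
Require Import Defs.
From HB Require Import structures.
From mathcomp Require Import all_boot all_order all_algebra.
From mathcomp Require Import reals.
From mathcomp.real_closed Require Import complex.
From mathcomp Require Import all_classical all_analysis.
From mathcomp Require Import ring lra finmap.

Set Implicit Arguments.
Unset Strict Implicit.
Unset Printing Implicit Defensive.

Import Order.TTheory GRing.Theory Num.Theory.
Import numFieldNormedType.Exports.
Local Open Scope classical_set_scope.
Local Open Scope ring_scope.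

(** The map [g x y = \sum_k P_k(x_{-k}, y_k)] is linear in [y], so a profile [x]
    with [g x y <= g x x] for every profile [y] is a Nash equilibrium: test it
    against the [y] that differ from [x] in a single entry.  Such an [x] exists
    because the set of profiles is compact and convex (a variational inequality
    of Hartman-Stampacchia type).  By compactness it suffices to treat finitely
    many test points [y_0, ..., y_n].  Label a point [x = \sum_i t_i y_i] of the
    simplex by an [i] such that [t_i > 0] and [g x y_i <= g x x]; one exists since
    [g x x = \sum_i t_i (g x y_i)].  This is a Sperner labelling, so fine iterated
    barycentric subdivisions contain small fully labelled simplices, and a
    cluster point of these is a solution.

    Sperner's lemma is proved homologically: simplices are sequences of vertices,
    mod 2 cochains are boolean functions on them, and subdivision commutes with
    the coboundary. *)

(** * Mod 2 cochains on vertex sequences and barycentric subdivision *)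

Section ModTwoCochains.
Variable T : Type.
Implicit Types (f : seq T -> bool) (s t u : seq T).

(* The empty sequence counts as a face of a vertex (augmented complex), so the
   coboundary formula for cones has no exceptional case. *)
Fixpoint coboundary f s : bool :=
  if s is x :: t then f t (+) coboundary (f \o cons x) t else false.

Fixpoint faces s : seq (seq T) :=
  if s is x :: t then t :: map (cons x) (faces t) else [::].

Lemma coboundaryE f s :
  coboundary f s = foldr (fun u => addb (f u)) false (faces s).
Proof.
elim: s f => //= x t IH f; rewrite IH; congr addb.
by elim: (faces t) => //= u l ->.
Qed.

End ModTwoCochains.

Section ModTwoCochainsEq.
Variable T : eqType.
Implicit Types (f : seq T -> bool) (s t u : seq T).

Lemma face_size s u : u \in faces s -> size s = (size u).+1.
Proof.
elim: s u => //= x t IH u; rewrite inE => /orP[/eqP->//|/mapP[v /IH h ->]] /=.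
by rewrite h.
Qed.

Lemma face_sub s u : u \in faces s -> {subset u <= s}.
Proof.
elim: s u => //= x t IH u; rewrite inE => /orP[/eqP-> y yt|/mapP[v /IH h ->] y].
  by rewrite inE yt orbT.
by rewrite !inE => /orP[->//|/h ->]; rewrite orbT.
Qed.

Lemma eq_coboundary f g s :
  {in faces s, f =1 g} -> coboundary f s = coboundary g s.
Proof.
rewrite !coboundaryE; elim: (faces s) => //= u l IH h.
rewrite h ?mem_head// IH// => v vl; apply: h; by rewrite inE vl orbT.
Qed.

Lemma coboundary0 s : coboundary (fun=> false) s = false.
Proof. by rewrite coboundaryE; elim: (faces s). Qed.

Lemma coboundaryD f g s :
  coboundary (fun t => f t (+) g t) s = coboundary f s (+) coboundary g s.
Proof. by rewrite !coboundaryE; elim: (faces s) => //= u l ->; rewrite addbACA. Qed.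

Lemma coboundary_coboundary f s : coboundary (coboundary f) s = false.
Proof.
elim: s f => //= x t IH f.
have -> : coboundary (coboundary f \o cons x) t
        = coboundary (fun u => f u (+) coboundary (f \o cons x) u) t by [].
by rewrite coboundaryD IH addbF addbb.
Qed.

Lemma coboundary_supp f s : coboundary f s -> exists2 u, u \in faces s & f u.
Proof.
rewrite coboundaryE; elim: (faces s) => //= u l IH.
case E: (f u) => h; first by exists u; rewrite ?mem_head.
by have [v vl fv] := IH h; exists v => //; rewrite inE vl orbT.
Qed.

(** Without signs the last vertex serves as cone apex just like the first. This isolates the facet
    opposite the last vertex in Sperner's argument. *)
Lemma coboundary_rcons f s x :
  coboundary f (rcons s x) = f s (+) coboundary (f \o rcons^~ x) s.
Proof.
elim: s f => [|y t IH] f /=; first by rewrite addbF.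
by rewrite IH /= addbCA.
Qed.

Variable bary : seq T -> T.

(* [Sd k f s], for [size s = k], is the value of [f] on the barycentric
   subdivision of the simplex [s], i.e. on the cone with apex [bary s] over the
   subdivided boundary of [s]. *)
Fixpoint Sd k f s : bool :=
  if k is k'.+1 then coboundary (Sd k' (f \o cons (bary s))) s else f s.

(** Such a [t] lists the barycenters of a flag of faces starting at [s], each with one vertex fewer
    than the preceding one; for [size s = k] the recursion ends at the empty sequence. *)
Fixpoint subsimplex k s t : Prop :=
  if k is k'.+1
  then exists2 u, u \in faces s &
       exists2 t', t = bary s :: t' & subsimplex k' u t'
  else t = s.

Lemma subsimplex_size k s t : size s = k -> subsimplex k s t -> size t = k.
Proof.
elim: k s t => [|k IH] s t sk /=; first by move->.
move=> [u us [t' -> h]] /=; rewrite (IH u)//.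
by have := face_size us; rewrite sk => -[].
Qed.

Lemma subsimplex_all (P : T -> Prop) k s t :
  (forall u, u != [::] -> (forall x, x \in u -> P x) -> P (bary u)) ->
  size s = k -> subsimplex k s t ->
  (forall x, x \in s -> P x) -> forall x, x \in t -> P x.
Proof.
move=> hP; elim: k s t => [|k IH] s t sk /=; first by move->.
move=> [u us [t' -> h]] Ps x; rewrite inE => /orP[/eqP->|].
  by apply: hP => //; case: s sk {us Ps}.
apply: (IH u) h _ x; first by have := face_size us; rewrite sk => -[].
by move=> y yu; apply: Ps; apply: face_sub yu.
Qed.

Lemma eq_Sd k f g s : size s = k ->
  (forall t, subsimplex k s t -> f t = g t) -> Sd k f s = Sd k g s.
Proof.
elim: k f g s => [|k IH] f g s sk h /=; first exact: h.
apply: eq_coboundary => u us; apply: IH.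
  by have := face_size us; rewrite sk => -[].
by move=> t ht /=; apply: h; exists u => //; exists t.
Qed.

Lemma SdD k f g s : Sd k (fun t => f t (+) g t) s = Sd k f s (+) Sd k g s.
Proof.
elim: k f g s => //= k IH f g s; rewrite -coboundaryD.
by apply: eq_coboundary => u _; rewrite -IH.
Qed.

Lemma Sd_supp k f s : Sd k f s -> exists2 t, subsimplex k s t & f t.
Proof.
elim: k f s => [|k IH] f s /=; first by exists s.
move=> /coboundary_supp[u us /IH[t ut ft]]; exists (bary s :: t) => //.
by exists u => //; exists t.
Qed.

(** On the cone with apex [bary s], the coboundary of [f] splits into [f] and [coboundary fb]. By
    induction the latter subdivides to a coboundary on each face, which the outer coboundary
    kills. *)
Lemma Sd_coboundary k f s : size s = k.+1 ->
  Sd k.+1 (coboundary f) s = coboundary (Sd k f) s.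
Proof.
elim: k f s => [|k IH] f s sk.
  by case: s sk => [|x [|]]//= _; rewrite !addbF.
set fb := f \o cons (bary s).
have -> : Sd k.+2 (coboundary f) s =
    coboundary (Sd k.+1 (fun t => f t (+) coboundary fb t)) s by [].
rewrite (@eq_coboundary _ (fun u => Sd k.+1 f u (+) coboundary (Sd k fb) u)).
  by rewrite coboundaryD coboundary_coboundary addbF.
move=> u us; rewrite SdD IH//; by have := face_size us; rewrite sk => -[].
Qed.

Fixpoint iter_subsimplex r k s t : Prop :=
  if r is r'.+1
  then exists2 u, subsimplex k s u & iter_subsimplex r' k u t else t = s.

Lemma iter_subsimplex_size r k s t :
  size s = k -> iter_subsimplex r k s t -> size t = k.
Proof.
elim: r s => [|r IH] s sk /=; first by move->.
by move=> [u /subsimplex_size-/(_ sk) uk]; apply: IH.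
Qed.

Lemma iter_subsimplex_all (P : T -> Prop) r k s t :
  (forall u, u != [::] -> (forall x, x \in u -> P x) -> P (bary u)) ->
  size s = k -> iter_subsimplex r k s t ->
  (forall x, x \in s -> P x) -> forall x, x \in t -> P x.
Proof.
move=> hP; elim: r s => [|r IH] s sk /=; first by move->.
move=> [u su ut] Ps; apply: (IH u) => //; first exact: subsimplex_size su.
exact: (subsimplex_all _ _ su).
Qed.

Lemma iter_Sd_supp r k f s :
  iter r (Sd k) f s -> exists2 t, iter_subsimplex r k s t & f t.
Proof.
elim: r s => [|r IH] s /=; first by exists s.
by move=> /Sd_supp[u su /IH[t ut ft]]; exists t => //; exists u.
Qed.

Lemma eq_iter_Sd r k f g s : size s = k ->
  (forall t, iter_subsimplex r k s t -> f t = g t) ->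
  iter r (Sd k) f s = iter r (Sd k) g s.
Proof.
elim: r s => [|r IH] s sk h /=; first exact: h.
apply: eq_Sd => // t st; apply: IH; first exact: subsimplex_size st.
by move=> u tu; apply: h; exists t.
Qed.

Lemma iter_Sd_coboundary r k f s : size s = k.+1 ->
  iter r (Sd k.+1) (coboundary f) s = coboundary (iter r (Sd k) f) s.
Proof.
elim: r s => [|r IH] s sk //.
rewrite [LHS]/(Sd k.+1 (iter r (Sd k.+1) (coboundary f)) s).
rewrite -[RHS]/(coboundary (Sd k (iter r (Sd k) f)) s) -[RHS]Sd_coboundary//.
apply: (eq_Sd sk) => t st.
by apply: IH; apply: subsimplex_size st.
Qed.

End ModTwoCochainsEq.


(** * Counting faces by their labels *)

Lemma coboundary_map (T U : Type) (lab : T -> U) f (s : seq T) :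
  coboundary (f \o map lab) s = coboundary f (map lab s).
Proof.
elim: s f => //= x s IH f; congr addb.
exact: (IH (f \o cons (lab x))).
Qed.

(** Each face of [l] deletes one position, and deleting [x] leaves a rearrangement of [J] exactly
    when [l] is one of [x :: J]. *)
Lemma coboundary_perm_eq (T : eqType) (J l : seq T) :
  coboundary (fun u => perm_eq u J) l = odd (count (fun x => perm_eq l (x :: J)) l).
Proof.
suff H : forall p, coboundary (fun u => perm_eq (p ++ u) J) l
         = odd (count (fun x => perm_eq (p ++ l) (x :: J)) l) by apply: (H [::]).
elim: l => //= x t IH p.
rewrite (perm_catCA p [:: x] t : perm_eql _ _) /= perm_cons oddD.
congr addb; first by case: perm_eq.
have := IH (rcons p x); rewrite cat_rcons => <-.
by rewrite !coboundaryE; elim: (faces t) => //= u r ->; rewrite cat_rcons.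
Qed.

(** A full labelling has exactly one face labelled by [iota 0 m]; any other labelling has none, or
    two, because the label outside such a face repeats one inside it. *)
Lemma coboundary_perm_iota m (l : seq nat) :
  size l = m.+1 -> {in l, forall x, x <= m}%N ->
  coboundary (fun u => perm_eq u (iota 0 m)) l = perm_eq l (iota 0 m.+1).
Proof.
move=> sl lm; rewrite coboundary_perm_eq.
have iotaS : perm_eq (m :: iota 0 m) (iota 0 m.+1).
  by rewrite -addn1 iotaD add0n /= cats1 perm_sym perm_rcons.
have key x z : perm_eq l (x :: iota 0 m) ->
    perm_eq l (z :: iota 0 m) = (z == x).
  move=> lx; rewrite (permPl lx) -(cat1s x (iota 0 m)) -(cat1s z (iota 0 m)).
  rewrite perm_cat2r; apply/idP/eqP => [|-> //].
  by move/perm_mem/(_ z); rewrite !inE eqxx => /eqP.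
have [lm1|nlm1] := boolP (perm_eq l (iota 0 m.+1)).
  have lx : perm_eq l (m :: iota 0 m) by rewrite (permPl lm1) perm_sym.
  rewrite (eq_count (key m ^~ lx)) count_uniq_mem ?(perm_uniq lx)/=.
    by rewrite (perm_mem lx) mem_head.
  by rewrite iota_uniq mem_iota add0n ltnn.
have [/hasP[x xl lx]|/hasPn h] :=
    boolP (has (fun x => perm_eq l (x :: iota 0 m)) l); last first.
  by rewrite (@eq_in_count _ _ pred0) ?count_pred0// => x /h/negbTE.
have xm : (x < m)%N.
  rewrite ltn_neqAle lm// andbT; apply: contra nlm1 => /eqP xm.
  by rewrite xm in lx; rewrite (permPl lx).
rewrite (eq_count (key x ^~ lx)) (permP lx) /= eqxx.
by rewrite count_uniq_mem ?iota_uniq// mem_iota add0n xm.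
Qed.

(** * Sperner's lemma for iterated barycentric subdivisions *)

Section Sperner.
Variables (T : eqType) (bary : seq T -> T) (e : nat -> T) (lab : T -> nat).
Variables (n : nat) (facet : nat -> T -> Prop).
Hypothesis facet_bary : forall i u,
  u != [::] -> (forall x, x \in u -> facet i x) -> facet i (bary u).
Hypothesis facet_vertex : forall i j, (j < n)%N -> i != j -> facet i (e j).
Hypothesis facet_lab : forall i x, facet i x -> lab x != i.

Lemma face_map (l : seq nat) u : uniq l -> u \in faces (map e l) ->
  exists2 i, i \in l &
    forall x, x \in u -> exists2 j, (j \in l) && (j != i) & x = e j.
Proof.
elim: l u => //= y l IH u /andP[yl ul]; rewrite inE => /orP[/eqP->|].
  exists y; rewrite ?mem_head// => x /mapP[j jl ->]; exists j => //.
  by rewrite inE jl orbT/=; apply: contraNneq yl => <-.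
case/mapP => v /(IH _ ul)[i il vi] ->; exists i; first by rewrite inE il orbT.
move=> x; rewrite inE => /predU1P[->|/vi[j /andP[jl ji] ->]].
  by exists y; rewrite // mem_head/=; apply: contraNneq yl => ->.
by exists j; rewrite // inE jl orbT.
Qed.

(** A subdivided cochain sums over the small simplices, so its value is the parity of the number of
    fully labelled ones. Induction on [m] moves the count to the boundary, where only the facet
    opposite [e m] contributes; [facet i] stands for the face opposite [e i]. *)
Lemma sperner_odd r m : (m <= n)%N ->
  iter r (Sd bary m) (fun t => perm_eq (map lab t) (iota 0 m))
    (map e (iota 0 m)).
Proof.
have facet_lab_iter k s t i : size s = k -> iter_subsimplex bary r k s t ->
    (forall x, x \in s -> facet i x) -> i \notin map lab t.
  move=> sk st sf; apply/mapP => -[x xt /eqP]; rewrite eq_sym; apply/negP.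
  apply: facet_lab; exact: (iter_subsimplex_all (P:=facet i) (@facet_bary i) sk st sf).
elim: m => [_|m IH mn]; first by elim: (r).
set s := map e (iota 0 m.+1).
have ss : size s = m.+1 by rewrite size_map size_iota.
pose g t := perm_eq (map lab t) (iota 0 m).
rewrite (@eq_iter_Sd _ bary r m.+1 _ (coboundary g)) //; last first.
  move=> t st; rewrite -(@coboundary_perm_iota m (map lab t)).
  - by rewrite -coboundary_map.
  - by rewrite size_map (iter_subsimplex_size ss st).
  (* A label [y > m] cannot occur, since all the vertices [e 0], ..., [e m] lie in [facet y]. *)
  move=> y yt; rewrite leqNgt; apply/negP => my.
  have : y \notin map lab t.
    apply: (facet_lab_iter _ _ _ _ ss st) => x /mapP[j]; rewrite mem_iota => jm ->.
    apply: facet_vertex; first by rewrite (leq_trans _ mn)//; case/andP: jm.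
    by rewrite neq_ltn (leq_ltn_trans _ my) ?orbT//; case/andP: jm.
  by rewrite yt.
rewrite iter_Sd_coboundary // /s -addn1 iotaD add0n map_cat /= cats1.
rewrite coboundary_rcons IH; last exact: ltnW.
rewrite (@eq_coboundary _ _ (fun=> false)) ?coboundary0// => u us /=.
(* A facet containing [e m] omits some [e i] with [i < m], so its subdivision stays in [facet i] and
   never shows the label [i]. *)
apply/negbTE/negP => /iter_Sd_supp[t ut gt].
have mu : size (rcons u (e m)) = m.
  by rewrite size_rcons -(face_size us) size_map size_iota.
have [i im ui] := face_map (iota_uniq 0 m) us.
have im' : (i < m)%N by move: im; rewrite mem_iota.
have : i \notin map lab t.
  apply: (facet_lab_iter _ _ _ _ mu ut) => x; rewrite mem_rcons inE.
  case/predU1P => [->|/ui[j /andP[jm ji] ->]]; last first.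
    apply: facet_vertex; last by rewrite eq_sym.
    by move: jm; rewrite mem_iota => /andP[_ /leq_trans->//]; exact: ltnW.
  by apply: facet_vertex; rewrite ?ltn_eqF.
by rewrite (perm_mem gt) im.
Qed.

End Sperner.

(** * Mesh of iterated barycentric subdivisions in a seminorm *)

Section Mesh.
Variables (R : realType) (W : lmodType R) (N : W -> R).
Hypothesis ND : forall u v, N (u + v) <= N u + N v.
Hypothesis NZ : forall a u, 0 <= a -> N (a *: u) = a * N u.
Hypothesis NN : forall u, N (- u) = N u.

Definition barycenter (s : seq W) : W := (size s)%:R^-1 *: \sum_(v <- s) v.

Let N0 : N 0 = 0. Proof. by rewrite -(scale0r 0) NZ// mul0r. Qed.

Lemma seminorm_sum (s : seq W) (c : W) :
  N (\sum_(v <- s) (v - c)) <= \sum_(v <- s) N (v - c).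
Proof.
elim: s => [|x s IH]; first by rewrite !big_nil N0.
by rewrite !big_cons (le_trans (ND _ _))// lerD2l.
Qed.

Lemma barycenterB (s : seq W) c : s != [::] ->
  barycenter s - c = (size s)%:R^-1 *: \sum_(v <- s) (v - c).
Proof.
move=> s0; rewrite big_split/= scalerDr; congr (_ + _).
rewrite big_const_seq count_predT iter_addr_0 -[- c *+ _]scaler_nat scalerA.
rewrite mulVf ?scale1r//.
by rewrite pnatr_eq0 size_eq0.
Qed.

Lemma barycenter_ball c r (u : seq W) : u != [::] ->
  (forall x, x \in u -> N (x - c) <= r) -> N (barycenter u - c) <= r.
Proof.
move=> u0 ur; have su : 0 < (size u)%:R :> R by rewrite ltr0n lt0n size_eq0.
rewrite barycenterB// NZ ?invr_ge0 ?ler0n// ler_pdivrMl//.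
rewrite (le_trans (seminorm_sum _ _))// big_seq.
rewrite (le_trans (ler_sum _ ur))// -big_seq big_const_seq count_predT iter_addr_0.
by rewrite mulr_natl.
Qed.

(** The barycenter of [p] points is within [(1 - 1/p) D] of each of them, as the term of the point
    itself vanishes. A fixed [K >= p] keeps the factor the same for all faces met in the
    induction. *)
Lemma subsimplex_mesh K D k s t : 0 <= D -> (k <= K)%N -> size s = k ->
  {in s &, forall x y, N (x - y) <= D} -> subsimplex barycenter k s t ->
  {in t &, forall x y, N (x - y) <= (1 - K%:R^-1) * D}.
Proof.
move=> D0; elim: k s t => [|k IH] s t kK sk sD /=.
  by move=> ->; rewrite (size0nil sk).
move=> [u us [t' -> ut']]; set b := barycenter s.
have K0 : 0 < K%:R :> R by rewrite ltr0n (leq_trans _ kK).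
have K1 : 0 <= (1 - K%:R^-1 : R).
  by rewrite subr_ge0 invf_le1// ler1n (leq_trans _ kK).
have su : size u = k by have := face_size us; rewrite sk => -[].
have sN0 : s != [::] by rewrite -size_eq0 sk.
have bt y : y \in t' -> N (y - b) <= (1 - K%:R^-1) * D.
  apply: (subsimplex_all (P := fun y => N (y - b) <= _) _ su ut').
    exact: barycenter_ball.
  move=> {}y /(face_sub us) ys; rewrite -NN opprB barycenterB//.
  rewrite NZ ?invr_ge0 ?ler0n// sk.
  have : N (\sum_(v <- s) (v - y)) <= k%:R * D.
    rewrite (le_trans (seminorm_sum _ _))// (big_rem y ys)/= subrr N0 add0r.
    rewrite big_seq (le_trans (ler_sum _ (_ : forall x, x \in rem y s -> _ <= D))).
    - by [].
    - by move=> x /mem_rem xs; exact: sD.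
    rewrite -big_seq big_const_seq count_predT iter_addr_0 size_rem// sk/=.
    by rewrite mulr_natl.
  have k0 : 0 < k.+1%:R :> R by rewrite ltr0n.
  move=> h; apply: (@le_trans _ _ (k.+1%:R^-1 * (k%:R * D))).
    by rewrite ler_pM2l ?invr_gt0.
  rewrite mulrA ler_wpM2r// (_ : _ * _ = 1 - k.+1%:R^-1).
    by rewrite lerD2l lerN2 lef_pV2 ?posrE// ler_nat.
  by rewrite -natr1; field; rewrite natr1 gt_eqF.
move=> x y; rewrite !inE => /predU1P[->|xt] /predU1P[->|yt].
- by rewrite subrr N0 mulr_ge0.
- by rewrite -NN opprB bt.
- exact: bt.
apply: (IH u t') => //; first exact: ltnW.
by move=> x' y' /(face_sub us) ? /(face_sub us) ?; exact: sD.
Qed.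

Lemma iter_subsimplex_mesh r k D s t : 0 <= D -> (0 < k)%N -> size s = k ->
  {in s &, forall x y, N (x - y) <= D} -> iter_subsimplex barycenter r k s t ->
  {in t &, forall x y, N (x - y) <= (1 - k%:R^-1) ^+ r * D}.
Proof.
move=> D0 k0; elim: r D D0 s => [|r IH] D D0 s sk sD /=.
  by move=> ->; rewrite expr0 mul1r.
move=> [u su ut]; rewrite exprSr -mulrA; apply: (IH _ _ u) => //.
- by rewrite mulr_ge0// subr_ge0 invf_le1 ?ltr0n ?ler1n.
- exact: subsimplex_size su.
exact: (subsimplex_mesh D0 (leqnn k)) su.
Qed.

End Mesh.

Definition convex_pred (R : realType) (W : lmodType R) (P : W -> Prop) :=
  forall (a : R) x y, 0 <= a <= 1 -> P x -> P y -> P (a *: x + (1 - a) *: y).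

Lemma barycenter_convex (R : realType) (W : lmodType R) (P : W -> Prop) (u : seq W) :
  convex_pred P -> u != [::] -> (forall x, x \in u -> P x) -> P (barycenter u).
Proof.
move=> cP; elim: u => // x [|y u] IH _ h.
  by rewrite /barycenter big_seq1/= invr1 scale1r; apply: h; rewrite mem_head.
set s := y :: u in IH h *.
have s0 : (size s)%:R != 0 :> R by rewrite pnatr_eq0.
have -> : barycenter (x :: s) = (size s).+1%:R^-1 *: x
    + (1 - (size s).+1%:R^-1) *: barycenter s.
  rewrite /barycenter big_cons scalerDr scalerA; congr (_ + _ *: _).
  by rewrite /= -!natr1 in s0 *; field; rewrite s0/= natr1 natr1 pnatr_eq0.
apply: cP; last by apply: IH => // z zs; apply: h; rewrite inE zs orbT.
- by rewrite invr_ge0 ler0n invf_le1 ?ltr0n// ler1n.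
- by apply: h; rewrite mem_head.
Qed.

(** * A variational inequality on a compact convex set *)

Section VariationalInequality.
Variables (R : realType) (V : normedModType R) (K : set V) (g : V -> V -> R).
Hypotheses (Kcompact : compact K) (Kconvex : convex_pred K).
Hypotheses (g_linear : forall x, scalar (g x)).
Hypothesis g_cont : forall y, continuous (g ^~ y).
Hypothesis g_diag_cont : continuous (fun x => g x x).

Section FiniteTests.
Variables (n : nat) (y : 'I_n.+1 -> V).
Hypothesis Ky : forall i, K (y i).

(** Faces and labels live on the weights [t] and not on points of [V], because the [y i] may be
    affinely dependent. *)
Let A (t : 'rV[R]_n.+1) : V := \sum_i t 0 i *: y i.

Let A_linear : linear A.
Proof.
move=> a u v; rewrite /A scaler_sumr -big_split; apply: eq_bigr => i _.
by rewrite !mxE scalerDl scalerA.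
Qed.

Let gA z t : g z (A t) = \sum_i t 0 i * g z (y i).
Proof.
have g0 : g z 0 = 0 by have := g_linear z 1 0 0; rewrite scale1r mul1r addr0; lra.
rewrite /A; elim/big_rec2: _ => [//|i u v _ <-]; exact: g_linear.
Qed.

(** For [j > n] the last condition is void and [in_face j] is the whole simplex. *)
Let in_face (j : nat) (t : 'rV[R]_n.+1) :=
  [/\ forall i, 0 <= t 0 i, \sum_i t 0 i = 1, K (A t)
    & forall i : 'I_n.+1, i = j :> nat -> t 0 i = 0].

Let good (t : 'rV[R]_n.+1) (i : 'I_n.+1) :=
  (0 < t 0 i) && (g (A t) (y i) <= g (A t) (A t)).

Let exists_good j t : in_face j t -> exists i, good t i.
Proof.
case=> t0 t1 _ _; apply: contrapT => /forallNP h.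
have ge0 i : 0 <= t 0 i * (g (A t) (y i) - g (A t) (A t)).
  have [ti|ti] := ltrP 0 (t 0 i); last first.
    by rewrite (_ : t 0 i = 0) ?mul0r//; apply/le_anti; rewrite ti t0.
  rewrite mulr_ge0// subr_ge0; apply: ltW; rewrite ltNge; apply/negP => hi.
  by apply: (h i); rewrite /good ti hi.
have s0 : \sum_i t 0 i * (g (A t) (y i) - g (A t) (A t)) = 0.
  under eq_bigr do rewrite mulrBr.
  by rewrite sumrB -gA -mulr_suml t1 mul1r subrr.
have z i : t 0 i = 0.
  have /eqP := psumr_eq0P (fun k _ => ge0 k) s0 (i := i) isT.
  rewrite mulf_eq0 => /orP[/eqP//|]; rewrite subr_eq0 => /eqP gi.
  apply/le_anti; rewrite t0 andbT leNgt; apply/negP => ti.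
  by apply: (h i); rewrite /good ti gi lexx.
by move: t1; rewrite big1 => [/eqP|//]; rewrite eq_sym oner_eq0.
Qed.

(** The default [ord0] is never taken on the simplex, where [exists_good] supplies an index. *)
Let lab t : nat := odflt ord0 [pick i | good t i].

Let lab_good j t : in_face j t -> exists2 i : 'I_n.+1, lab t = i & good t i.
Proof.
move=> /exists_good[i gi]; rewrite /lab; case: pickP => [k gk|/(_ i)].
  by exists k.
by rewrite gi.
Qed.

Let e (j : nat) : 'rV[R]_n.+1 := delta_mx 0 (inord j).

Let Ae j : A (e j) = y (inord j).
Proof.
rewrite /A (bigD1 (inord j))//= !mxE !eqxx scale1r big1 ?addr0// => i ij.
by rewrite !mxE (negbTE ij) andbF scale0r.
Qed.

Let in_face_convex j : convex_pred (in_face j).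
Proof.
move=> a u v /andP[a0 a1] [u0 u1 Ku uj] [v0 v1 Kv vj].
have a1' : 0 <= 1 - a by rewrite subr_ge0.
split.
- by move=> i; rewrite !mxE addr_ge0// mulr_ge0.
- under eq_bigr do rewrite !mxE.
  by rewrite big_split/= -!mulr_sumr u1 v1 !mulr1 addrC subrK.
- rewrite A_linear -[_ *: v]addr0 A_linear.
  have A0 : A 0 = 0 by rewrite /A big1// => i _; rewrite mxE scale0r.
  by rewrite A0 addr0; apply: Kconvex => //; rewrite a0.
- by move=> i ij; rewrite !mxE uj// vj// !mulr0 addr0.
Qed.

Let in_face_vertex i j : (j < n.+1)%N -> i != j -> in_face i (e j).
Proof.
move=> jn ij; split.
- by move=> k; rewrite !mxE; case: (_ && _).
- rewrite (bigD1 (inord j))//= big1 ?mxE ?eqxx ?addr0// => k kj.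
  by rewrite !mxE (negbTE kj) andbF.
- by rewrite Ae.
- move=> k ki; rewrite !mxE /= [k == _](_ : _ = false)//.
  by apply/negbTE; rewrite -val_eqE/= ki inordK.
Qed.

(** Every label occurs on a small fully labelled simplex: [z] comes from its first vertex and [z']
    from the vertex labelled [i]. *)
Lemma approximate_solution eps : 0 < eps -> exists2 z, K z &
  forall i, exists z', [/\ K z', `|z - z'| < eps & g z' (y i) <= g z' z'].
Proof.
move=> eps0.
set s := map e (iota 0 n.+1).
have ss : size s = n.+1 by rewrite size_map size_iota.
(* [A] may have a kernel, so this is only a seminorm. *)
pose N t := `|A t|.
have A0 : A 0 = 0 by rewrite /A big1// => i _; rewrite mxE scale0r.
have AD u v : A (u + v) = A u + A v by have := A_linear 1 u v; rewrite !scale1r.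
have AZ a u : A (a *: u) = a *: A u.
  by have := A_linear a u 0; rewrite !addr0 A0 addr0.
have AN u : A (- u) = - A u by rewrite -scaleN1r AZ scaleN1r.
have ND u v : N (u + v) <= N u + N v by rewrite /N AD ler_normD.
have NZ a u : 0 <= a -> N (a *: u) = a * N u.
  by move=> a0; rewrite /N AZ normrZ ger0_norm.
have NN u : N (- u) = N u by rewrite /N AN normrN.
pose D := \sum_(u <- s) \sum_(v <- s) N (u - v).
have N_ge0 u : 0 <= N u by exact: normr_ge0.
have D0 : 0 <= D by apply: sumr_ge0 => u _; apply: sumr_ge0.
have sD : {in s &, forall u v, N (u - v) <= D}.
  move=> u v us vs; rewrite /D (big_rem u us)/= (big_rem v vs)/= -addrA lerDl.
  by rewrite addr_ge0// sumr_ge0// => w _; rewrite sumr_ge0.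
have [r hr] : exists r, (1 - n.+1%:R^-1) ^+ r * D < eps.
  have c0 : `|1 - n.+1%:R^-1 : R| < 1.
    rewrite ger0_norm; first by rewrite ltrBlDr ltrDl invr_gt0 ltr0n.
    by rewrite subr_ge0 invf_le1 ?ltr0n// ler1n.
  have : (fun r => (1 - n.+1%:R^-1) ^+ r * D) @ \oo --> 0.
    by rewrite -[X in _ --> X](mul0r D); apply: cvgMl; exact: cvg_expr.
  move=> /cvgrPdist_lt/(_ _ eps0)[r _ /(_ r (leqnn _))].
  rewrite sub0r normrN => h; exists r; exact: le_lt_trans (ler_norm _) h.
have lab_face i t : in_face i t -> lab t != i.
  move=> fi; have [k -> /andP[tk _]] := lab_good fi.
  case: fi => _ _ _ /(_ k) h; apply/eqP => /h tk0; by rewrite tk0 ltxx in tk.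
have := sperner_odd (bary := @barycenter R _) (e := e) (lab := lab)
  (n := n.+1) (facet := in_face)
  (fun i u => @barycenter_convex _ _ _ u (@in_face_convex i))
  in_face_vertex lab_face r (leqnn n.+1).
move=> /iter_Sd_supp[t st labt].
have tn : size t = n.+1 := iter_subsimplex_size ss st.
(* No index in ['I_n.+1] equals [n.+1], so this face is the whole simplex. *)
have tface : forall x, x \in t -> in_face n.+1 x.
  apply: (iter_subsimplex_all _ ss st).
    by move=> u; apply: barycenter_convex; exact: in_face_convex.
  move=> x /mapP[j]; rewrite mem_iota add0n => /andP[_ jn] ->.
  by apply: in_face_vertex; rewrite // gtn_eqF.
have tmesh := iter_subsimplex_mesh ND NZ NN D0 (ltn0Sn n) ss sD st.
have x0t : head 0 t \in t by case: (t) tn => //= ? ? _; rewrite mem_head.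
exists (A (head 0 t)); first by case: (tface _ x0t).
move=> i.
have /mapP[x xt ix] : val i \in map lab t.
  by rewrite (perm_mem labt) mem_iota/= ltn_ord.
exists (A x); split.
- by case: (tface _ xt).
- by rewrite -AN -AD; apply: le_lt_trans (tmesh _ _ x0t xt) hr.
- have [k lk /andP[_]] := lab_good (tface _ xt).
  by rewrite (_ : k = i)//; apply: val_inj; rewrite /= -lk ix.
Qed.

(** An inequality failing at a cluster point would fail on a ball of some radius [d]. Half of [d]
    covers the distance to some [z r], the other half that from [z r] to its [z'], where the
    inequality holds. *)
Lemma finite_variational_inequality :
  exists2 x, K x & forall i, g x (y i) <= g x x.
Proof.
have /choice[z zP] : forall r : nat, exists z, K z /\
    forall i, exists z', [/\ K z', `|z - z'| < r.+1%:R^-1 & g z' (y i) <= g z' z'].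
  move=> r; have [|z Kz h] := @approximate_solution r.+1%:R^-1.
    by rewrite invr_gt0.
  by exists z.
have [|p [Kp clp]] := Kcompact (F := z @ \oo).
  have KF : \forall r \near \oo, K (z r) by apply: nearW => r; exact: (zP r).1.
  exact: KF.
exists p => // i; rewrite leNgt; apply/negP => hp.
have : \forall x \near p, 0 < g x (y i) - g x x.
  have c : (fun x => g x (y i) - g x x) @ p --> g p (y i) - g p p.
    by apply: cvgB; [exact: g_cont|exact: g_diag_cont].
  by apply: (cvgr_gt _ c); rewrite subr_gt0.
move=> /nbhs_ballP[d /= d0 dP].
have d2 : 0 < d / 2 by rewrite divr_gt0.
pose B := [set x | exists z', `|x - z'| < d / 2 /\ g z' (y i) <= g z' z'].
have FB : \forall r \near \oo, B (z r).
  near=> r; have [z' [_ h1 h2]] := (zP r).2 i; exists z'; split => //.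
  apply: lt_trans h1 _; near: r; exact: near_infty_natSinv_lt (PosNum d2).
have [] := clp B (ball p (d / 2)) FB; first exact: nbhsx_ballx.
move=> x [[z' [h1 h2]]] px.
suff /dP : ball p d z' by rewrite /= subr_gt0 ltNge h2.
by rewrite (splitr d); apply: ball_triangle px _; rewrite -ball_normE.
Unshelve. all: by end_near.
Qed.

End FiniteTests.

(** If there were no solution, the open sets [0 < g x y - g x x] would cover [K]; the tests [y] of a
    finite subcover contradict the finite case. *)
Lemma variational_inequality : K !=set0 ->
  exists2 x, K x & forall y, K y -> g x y <= g x x.
Proof.
move=> [k0 Kk0]; apply: contrapT => hno.
have : cover_compact K by rewrite -compact_cover.
move=> /(_ V K (fun y => [set x | 0 < g x y - g x x])).
case.
- move=> y _; apply: open_comp (@open_gt _ 0) => x _.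
  by apply: cvgB; [exact: g_cont|exact: g_diag_cont].
- move=> x Kx; apply: contrapT => hx; apply: hno; exists x => // y Ky.
  rewrite leNgt; apply/negP => h; apply: hx; exists y => //=.
  by rewrite subr_gt0.
move=> F FK cov.
(* The point [k0] makes the list of tests nonempty, as the index type ['I_n.+1] demands. *)
set s := k0 :: enum_fset F.
have sK : forall i : 'I_(size (enum_fset F)).+1, K (tnth (in_tuple s) i).
  move=> i; have : tnth (in_tuple s) i \in s by exact: mem_tnth.
  move: (tnth _ _) => w; rewrite inE => /predU1P[->//|/FK].
  by rewrite in_setE.
have [x Kx hx] := finite_variational_inequality sK.
have [y yF] := cov x Kx.
have /tnthP[i yi] : y \in in_tuple s by rewrite inE; apply/orP; right.
by rewrite /= subr_gt0 yi ltNge hx.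
Qed.

End VariationalInequality.

(** * Adjoints, reality of the payoffs and their linearity in each strategy *)

Section Adjoint.
Variable R : realType.
Local Notation C := (R[i]).

Lemma dagE m p (A : 'M[C]_(m, p)) i j : dag A i j = (A j i)^*.
Proof. by rewrite !mxE. Qed.

Lemma dagD m p (A B : 'M[C]_(m, p)) : dag (A + B) = dag A + dag B.
Proof. by apply/matrixP => i j; rewrite !mxE rmorphD. Qed.

Lemma dagZ m p c (A : 'M[C]_(m, p)) : dag (c *: A) = c^* *: dag A.
Proof. by apply/matrixP => i j; rewrite !mxE rmorphM. Qed.

Lemma dag0 m p : dag (0 : 'M[C]_(m, p)) = 0.
Proof. by apply/matrixP => i j; rewrite !mxE rmorph0. Qed.

Lemma dag_sum m p I (r : seq I) (F : I -> 'M[C]_(m, p)) :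
  dag (\sum_(i <- r) F i) = \sum_(i <- r) dag (F i).
Proof. exact: (big_morph _ (@dagD m p) (@dag0 m p)). Qed.

Lemma dagM m p l (A : 'M[C]_(m, p)) (B : 'M[C]_(p, l)) :
  dag (A *m B) = dag B *m dag A.
Proof. by rewrite /dag map_mxM trmx_mul. Qed.

Lemma dagK m p (A : 'M[C]_(m, p)) : dag (dag A) = A.
Proof. by apply/matrixP => i j; rewrite !dagE conjCK. Qed.

Lemma mxtrace_dag m (A : 'M[C]_m) : \tr (dag A) = (\tr A)^*.
Proof. by rewrite /mxtrace rmorph_sum; apply: eq_bigr => i _; rewrite dagE. Qed.

Lemma conj_realc (x : R) : (x%:C%C)^* = x%:C%C.
Proof. exact: conjc_real. Qed.

Lemma dag_tens N n (F : 'I_N -> 'M[C]_n) :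
  dag (tens F) = tens (fun k => dag (F k)).
Proof.
by apply/matrixP => i j; rewrite !mxE rmorph_prod; apply: eq_bigr => k _; rewrite dagE.
Qed.

Lemma dag_Rop D L (M : 'I_L -> 'M[C]_D) (ak : 'I_L -> R) :
  dag (Rop M ak) = Rop M ak.
Proof.
rewrite /Rop dag_sum; apply: eq_bigr => m _.
by rewrite dagZ conj_realc dagM dagK.
Qed.

(** The conjugate of a trace is the trace of the adjoint, which reverses the factors; cyclicity
    restores their order with [al] and [be] exchanged. *)
Lemma Acoef_conj N d n (E : 'I_d -> 'M[C]_n) (rho Rk : 'M[C]_(cdim N n)) al be :
  dag rho = rho -> dag Rk = Rk ->
  (Acoef E rho Rk al be)^* = Acoef E rho Rk be al.
Proof.
move=> hrho hR; rewrite /Acoef -mxtrace_dag !dagM hrho hR !dag_tens.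
rewrite !mulmxA -mxtrace_mulC !mulmxA.
rewrite [tens (fun k => dag (dag _))](_ : _ = tens (fun k => E (be k)))//.
by apply/matrixP => i j; rewrite !mxE; apply: eq_bigr => k _; rewrite dagK.
Qed.

(** Comparison in [C] requires equal imaginary parts, so payoffs have to be known real. Conjugation
    exchanges [al] and [be] in both the coefficients and the Hermitian entries. *)
Lemma payoff_conj N d n (E : 'I_d -> 'M[C]_n) (rho Rk : 'M[C]_(cdim N n))
    (chi : 'I_N -> 'M[C]_d) :
  dag rho = rho -> dag Rk = Rk -> (forall k, dag (chi k) = chi k) ->
  (payoff E rho Rk chi)^* = payoff E rho Rk chi.
Proof.
move=> hrho hR hchi; rewrite /payoff rmorph_sum exchange_big.
apply: eq_bigr => al _; rewrite rmorph_sum; apply: eq_bigr => be _.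
rewrite rmorphM; congr (_ * _); last exact: Acoef_conj.
rewrite rmorph_prod.
by apply: eq_bigr => k _; rewrite -{2}hchi dagE.
Qed.

Lemma payoff_upd N d n (E : 'I_d -> 'M[C]_n) (rho Rk : 'M[C]_(cdim N n))
    (chi : 'I_N -> 'M[C]_d) k X :
  payoff E rho Rk (upd chi k X) =
  \sum_(al : {ffun 'I_N -> 'I_d}) \sum_(be : {ffun 'I_N -> 'I_d})
     X (al k) (be k) *
     ((\prod_(j < N | j != k) chi j (al j) (be j)) * Acoef E rho Rk al be).
Proof.
apply: eq_bigr => al _; apply: eq_bigr => be _.
rewrite mulrA (bigD1 k)//= /upd eqxx; congr (_ * _ * _).
by apply: eq_bigr => j /negbTE ->.
Qed.

Lemma payoff_upd_linear N d n (E : 'I_d -> 'M[C]_n) (rho Rk : 'M[C]_(cdim N n))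
    (chi : 'I_N -> 'M[C]_d) k c X Y :
  payoff E rho Rk (upd chi k (c *: X + Y)) =
  c * payoff E rho Rk (upd chi k X) + payoff E rho Rk (upd chi k Y).
Proof.
rewrite !payoff_upd mulr_sumr -big_split; apply: eq_bigr => al _.
rewrite mulr_sumr -big_split; apply: eq_bigr => be _ /=.
by rewrite !mxE mulrDl -mulrA.
Qed.

Lemma ReM_real (x : R) (z : C) : complex.Re (x%:C%C * z) = x * complex.Re z.
Proof. by case: z => a b /=; rewrite mul0r subr0. Qed.

Lemma ReD (x y : C) : complex.Re (x + y) = complex.Re x + complex.Re y.
Proof. by case: x; case: y. Qed.

Lemma ImD (x y : C) : complex.Im (x + y) = complex.Im x + complex.Im y.
Proof. by case: x; case: y. Qed.

Lemma Im_eq0_conj (z : C) : z^* = z -> complex.Im z = 0.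
Proof. by case: z => x y [] h /=; lra. Qed.

End Adjoint.

(** * Continuity and closed conditions for complex-valued functions *)

Section ComplexContinuity.
Variables (R : realType) (T : topologicalType).
Local Notation C := (R[i]).

(* Continuity with respect to the topology of [R] on both parts, the one for
   which Heine-Borel is available on ['rV[R]_m]. *)
Definition ccontinuous (f : T -> C) :=
  continuous (fun x => complex.Re (f x)) /\ continuous (fun x => complex.Im (f x)).

Lemma ccontinuous_cst c : ccontinuous (fun=> c).
Proof. by split => x; exact: cvg_cst. Qed.

Lemma ccontinuousD f g : ccontinuous f -> ccontinuous g ->
  ccontinuous (fun x => f x + g x).
Proof.
move=> [f1 f2] [g1 g2]; split.
  under [X in continuous X]funext do rewrite ReD.
  by move=> x; apply: cvgD; [exact: f1|exact: g1].
under [X in continuous X]funext do rewrite ImD.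
by move=> x; apply: cvgD; [exact: f2|exact: g2].
Qed.

Lemma ccontinuousM f g : ccontinuous f -> ccontinuous g ->
  ccontinuous (fun x => f x * g x).
Proof.
move=> [f1 f2] [g1 g2]; split.
  rewrite (_ : (fun _ => _) = fun x => complex.Re (f x) * complex.Re (g x)
     - complex.Im (f x) * complex.Im (g x)); last first.
    by apply/funext => x; case: (f x); case: (g x).
  move=> x; apply: cvgB; apply: cvgM.
  - exact: f1.
  - exact: g1.
  - exact: f2.
  - exact: g2.
rewrite (_ : (fun _ => _) = fun x => complex.Re (f x) * complex.Im (g x)
   + complex.Im (f x) * complex.Re (g x)); last first.
  by apply/funext => x; case: (f x); case: (g x).
move=> x; apply: cvgD; apply: cvgM.
- exact: f1.
- exact: g2.
- exact: f2.
- exact: g1.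
Qed.

Lemma ccontinuous_conj f : ccontinuous f -> ccontinuous (fun x => (f x)^*).
Proof.
move=> [f1 f2]; split.
  rewrite (_ : (fun _ => _) = fun x => complex.Re (f x))//.
  by apply/funext => x; case: (f x).
rewrite (_ : (fun _ => _) = fun x => - complex.Im (f x)).
  by move=> x; apply: cvgN; exact: f2.
by apply/funext => x; case: (f x).
Qed.

Lemma ccontinuous_sum I (r : seq I) P (F : I -> T -> C) :
  (forall i, ccontinuous (F i)) -> ccontinuous (fun x => \sum_(i <- r | P i) F i x).
Proof.
move=> Fc; elim: r => [|i r IH].
  by under [X in ccontinuous X]funext do rewrite big_nil; exact: ccontinuous_cst.
under [X in ccontinuous X]funext do rewrite big_cons.
by case: (P i) => //; exact: ccontinuousD.
Qed.

Lemma ccontinuous_prod I (r : seq I) P (F : I -> T -> C) :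
  (forall i, ccontinuous (F i)) -> ccontinuous (fun x => \prod_(i <- r | P i) F i x).
Proof.
move=> Fc; elim: r => [|i r IH].
  by under [X in ccontinuous X]funext do rewrite big_nil; exact: ccontinuous_cst.
under [X in ccontinuous X]funext do rewrite big_cons.
by case: (P i) => //; exact: ccontinuousM.
Qed.

Lemma closed_forall I (F : I -> set T) :
  (forall i, closed (F i)) -> closed [set x | forall i, F i x].
Proof.
move=> Fc x clx i; apply: Fc => B /clx[y [Fy By]].
by exists y; split => //; exact: Fy.
Qed.

Lemma closed_ceq0 f : ccontinuous f -> closed [set x | f x = 0].
Proof.
move=> [f1 f2].
rewrite (_ : [set x | _] = (fun x => complex.Re (f x)) @^-1` [set 0]
   `&` (fun x => complex.Im (f x)) @^-1` [set 0]); last first.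
  apply/seteqP; split => x /=; first by move=> ->.
  by case: (f x) => a b /= [-> ->].
apply: closedI; apply: closed_comp.
- by move=> x _; exact: f1.
- exact: closed_eq.
- by move=> x _; exact: f2.
- exact: closed_eq.
Qed.

Lemma closed_cge0 f : ccontinuous f -> closed [set x | 0 <= f x].
Proof.
move=> [f1 f2].
rewrite (_ : [set x | _] = (fun x => complex.Re (f x)) @^-1` [set r | 0 <= r]
   `&` (fun x => complex.Im (f x)) @^-1` [set 0]); last first.
  apply/seteqP; split => x /=; rewrite lecE /=.
    by move=> /andP[/eqP-> ->].
  by move=> [-> ->]; rewrite eqxx.
apply: closedI; apply: closed_comp.
- by move=> x _; exact: f1.
- exact: closed_ge.
- by move=> x _; exact: f2.
- exact: closed_eq.
Qed.

End ComplexContinuity.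

(** * Convexity, nonemptiness and boundedness of the strategy set *)

Section StrategySet.
Variable R : realType.
Local Notation C := (R[i]).

Definition qform m (X : 'M[C]_m) (u v : 'cV[C]_m) : C := (dag u *m X *m v) 0 0.

Section Sesquilinear.
Variables (m : nat) (X : 'M[C]_m).

Lemma qformDl u v w : qform X (u + v) w = qform X u w + qform X v w.
Proof. by rewrite /qform dagD !mulmxDl mxE. Qed.

Lemma qformDr u v w : qform X w (u + v) = qform X w u + qform X w v.
Proof. by rewrite /qform mulmxDr mxE. Qed.

Lemma qformZl c u w : qform X (c *: u) w = c^* * qform X u w.
Proof. by rewrite /qform dagZ -!scalemxAl mxE. Qed.

Lemma qformZr c u w : qform X w (c *: u) = c * qform X w u.
Proof. by rewrite /qform -scalemxAr mxE. Qed.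

Lemma qformE u v : qform X u v = \sum_a \sum_b (u a 0)^* * X a b * v b 0.
Proof.
rewrite /qform mxE exchange_big; apply: eq_bigr => b _.
by rewrite mxE mulr_suml; apply: eq_bigr => a _; rewrite dagE.
Qed.

Lemma qform_delta a b : qform X (delta_mx a 0) (delta_mx b 0) = X a b.
Proof.
rewrite qformE (bigD1 a)//= [X in _ + X]big1 ?addr0 => [|a' /negbTE aa]; last first.
  by rewrite big1// => b' _; rewrite !mxE aa rmorph0 !mul0r.
rewrite (bigD1 b)//= big1 ?addr0 => [|b' /negbTE bb]; last first.
  by rewrite !mxE bb mulr0.
by rewrite !mxE !eqxx rmorph1 mul1r mulr1.
Qed.

End Sesquilinear.

Lemma qform_linear m c (X Y : 'M[C]_m) u v :
  qform (c *: X + Y) u v = c * qform X u v + qform Y u v.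
Proof. by rewrite /qform mulmxDr mulmxDl -scalemxAr -scalemxAl !mxE. Qed.

Variables (d n : nat) (E : 'I_d -> 'M[C]_n).

Let trace_preserving (X : 'M[C]_d) : 'M[C]_n :=
  \sum_(a < d) \sum_(b < d) (X a b)^* *: (dag (E a) *m E b).

Lemma Omega_convex (t : R) X Y : 0 <= t <= 1 -> Omega E X -> Omega E Y ->
  Omega E (t%:C%C *: X + (1 - t)%:C%C *: Y).
Proof.
move=> /andP[t0 t1] [[Xh Xp] XE] [[Yh Yp] YE].
have t1' : 0 <= 1 - t by rewrite subr_ge0.
split; first split.
- by rewrite dagD !dagZ !conj_realc Xh Yh.
- move=> v; rewrite -/(qform _ v v) qform_linear -[_ *: Y]addr0 qform_linear.
  rewrite [qform 0 _ _](_ : _ = 0) ?addr0; last first.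
    by rewrite /qform mulmx0 mul0mx mxE.
  by rewrite addr_ge0// mulr_ge0// ?ler0c//; [exact: Xp|exact: Yp].
transitivity (t%:C%C *: trace_preserving X + (1 - t)%:C%C *: trace_preserving Y).
  rewrite !scaler_sumr -big_split; apply: eq_bigr => a _.
  rewrite !scaler_sumr -big_split; apply: eq_bigr => b _ /=.
  by rewrite !mxE rmorphD !rmorphM/= !conj_realc scalerDl !scalerA.
rewrite /trace_preserving XE YE -scalerDl -rmorphD/= addrC subrK.
by rewrite rmorph1 scale1r.
Qed.

Hypothesis Ebasis : is_basis E.

(** The witness is the chi matrix of the identity channel, whose single Kraus operator [1%:M] has
    coordinates [c]. *)
Lemma Omega_nonempty : exists X, Omega E X.
Proof.
have [_ /(_ 1%:M)[c c1]] := Ebasis.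
pose v : 'cV[C]_d := \col_a c a.
exists (v *m dag v); split; first split.
- by rewrite dagM dagK.
- move=> u; rewrite mulmxA -mulmxA.
  rewrite (_ : dag u *m v = dag (dag v *m u)); last by rewrite dagM dagK.
  by rewrite mxE big_ord1 dagE mulrC mul_conjC_ge0.
transitivity (dag (1%:M : 'M[C]_n) *m 1%:M).
  rewrite c1 dag_sum mulmx_suml; apply: eq_bigr => a _.
  rewrite mulmx_sumr; apply: eq_bigr => b _.
  rewrite mxE big_ord1 dagE !mxE rmorphM/= conjCK dagZ.
  by rewrite -scalemxAl -scalemxAr scalerA.
by rewrite mulmx1; apply/matrixP => i j; rewrite dagE !mxE rmorph_nat eq_sym.
Qed.

(** The vectors with this property form a subspace, so checking a spanning family suffices. *)
Let bounded_at (v : 'cV[C]_d) :=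
  exists B : R, forall X, Omega E X -> complex.Re (qform X v v) <= B.

Lemma psd_qform_Re m (X : 'M[C]_m) v : psd X -> 0 <= complex.Re (qform X v v).
Proof. by case=> _ /(_ v); rewrite lecE => /andP[]. Qed.

(** Parallelogram law: the forms at [u + v] and [u - v] add up to twice those at [u] and [v], and
    the one at [u - v] is nonnegative. *)
Let bounded_atD u v : bounded_at u -> bounded_at v -> bounded_at (u + v).
Proof.
move=> [B hB] [B' hB']; exists (2 * B + 2 * B') => X OX.
have p := psd_qform_Re (u - v) OX.1.
have := hB _ OX; have := hB' _ OX; move: p.
have -> : u - v = u + (-1) *: v by rewrite scaleN1r.
rewrite !(qformDl, qformDr, qformZl, qformZr) rmorphN1 !mulN1r opprK.
rewrite !ReD !raddfN/=; lra.
Qed.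

Lemma conj_mul_Re (c z : C) : complex.Re (c^* * (c * z)) =
  (complex.Re c ^+ 2 + complex.Im c ^+ 2) * complex.Re z.
Proof. by case: c => x y; case: z => z w /=; ring. Qed.

Let bounded_atZ c v : bounded_at v -> bounded_at (c *: v).
Proof.
move=> [B hB]; exists ((complex.Re c ^+ 2 + complex.Im c ^+ 2) * B) => X OX.
by rewrite qformZl qformZr conj_mul_Re ler_wpM2l ?hB// addr_ge0// sqr_ge0.
Qed.

Let bounded_at0 : bounded_at 0.
Proof. by exists 0 => X _; rewrite /qform mulmx0 mxE. Qed.

Let bounded_at_sum I (r : seq I) (F : I -> 'cV[C]_d) :
  (forall i, bounded_at (F i)) -> bounded_at (\sum_(i <- r) F i).
Proof. by move=> Fb; elim/big_ind: _. Qed.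

(* The (j, j) entry of the trace-preservation constraint bounds the quadratic
   form of [X] at each of the vectors [w i j]; these span the whole space
   because the [E a] are linearly independent. *)
Let w (i j : 'I_n) : 'cV[C]_d := \col_a (E a i j)^*.

Let bounded_at_w i j : bounded_at (w i j).
Proof.
exists 1 => X [Xpsd /matrixP/(_ j j)] h.
have {}h : \sum_i qform X (w i j) (w i j) = 1.
  move: h => /(congr1 Num.conj); rewrite !mxE eqxx rmorph1 => <-.
  under eq_bigr do rewrite qformE.
  rewrite exchange_big summxE rmorph_sum; apply: eq_bigr => a _.
  rewrite exchange_big summxE rmorph_sum; apply: eq_bigr => b _.
  rewrite !mxE rmorphM/= conjCK rmorph_sum mulr_sumr.
  apply: eq_bigr => k _; rewrite !mxE /= rmorphM/= !conjCK; ring.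
have -> : 1 = complex.Re (1 : C) by [].
(* The other summands are nonnegative, so the one at [i] is at most the total. *)
rewrite -h (bigD1 i)//= ReD lerDl.
elim/big_ind: _ => [//|x y x0 y0|k _]; first by rewrite ReD addr_ge0.
exact: psd_qform_Re.
Qed.

(** Expand each [E b] in elementary matrices and these in the basis, with coefficients [D];
    independence gives [\sum_i \sum_j E b i j * D (i, j) a = (a == b)], whose conjugate is the
    claim. *)
Let delta_span a : exists c : 'I_n -> 'I_n -> C,
  delta_mx a 0 = \sum_i \sum_j c i j *: w i j.
Proof.
have [Eindep Espan] := Ebasis.
have /choice[D hD] : forall ij : 'I_n * 'I_n, exists c : 'I_d -> C,
  delta_mx ij.1 ij.2 = \sum_(a < d) c a *: E a by move=> ij; exact: Espan.
exists (fun i j => (D (i, j) a)^*); apply/matrixP => b k; rewrite ord1 {k}.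
have := Eindep (fun a => \sum_i \sum_j E b i j * D (i, j) a - (a == b)%:R).
rewrite (_ : \sum_(_ < _) _ = 0).
  move=> /(_ erefl a)/eqP; rewrite subr_eq0 => /eqP /(congr1 Num.conj).
  rewrite rmorph_nat !mxE eqxx andbT eq_sym => <-.
  rewrite rmorph_sum summxE; apply: eq_bigr => i _.
  rewrite rmorph_sum summxE; apply: eq_bigr => j _.
  by rewrite !mxE rmorphM mulrC.
under eq_bigr do rewrite scalerBl.
rewrite sumrB [X in _ - X](_ : _ = E b); last first.
  rewrite (bigD1 b)//= eqxx scale1r big1 ?addr0// => a' /negbTE ->.
  by rewrite scale0r.
apply/eqP; rewrite subr_eq0; apply/eqP; rewrite [RHS]matrix_sum_delta.
under eq_bigr do rewrite scaler_suml.
rewrite exchange_big; apply: eq_bigr => i _.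
under eq_bigr do rewrite scaler_suml.
rewrite exchange_big; apply: eq_bigr => j _.
rewrite (hD (i, j)) scaler_sumr; apply: eq_bigr => a' _.
by rewrite scalerA.
Qed.

(** Nonnegativity at [delta_mx a 0 + c *: delta_mx b 0] bounds the real part of [c * X a b] from
    below; taking [c] to be 1, -1, i and -i bounds both parts on both sides. *)
Lemma psd_entry m (X : 'M[C]_m) a b : psd X ->
  `|complex.Re (X a b)| <= complex.Re (X a a) + complex.Re (X b b) /\
  `|complex.Im (X a b)| <= complex.Re (X a a) + complex.Re (X b b).
Proof.
move=> Xpsd.
have Xh : X b a = (X a b)^* by rewrite -[in LHS]Xpsd.1 dagE.
have H c : 0 <= complex.Re (X a a) + 2 * complex.Re (c * X a b)
    + (complex.Re c ^+ 2 + complex.Im c ^+ 2) * complex.Re (X b b).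
  have := psd_qform_Re (delta_mx a 0 + c *: delta_mx b 0) Xpsd.
  rewrite !(qformDl, qformDr) !qformZl !qformZr !qform_delta.
  rewrite !ReD conj_mul_Re Xh -rmorphM (_ : complex.Re (_^*) = complex.Re (c * X a b)).
    lra.
  by case: (c * _).
have h0 : 0 <= complex.Re (X a a) by rewrite -qform_delta psd_qform_Re.
have h0' : 0 <= complex.Re (X b b) by rewrite -qform_delta psd_qform_Re.
have H1 := H 1; have H2 := H (-1).
have H3 := H (Complex 0 1); have H4 := H (Complex 0 (-1)).
move: H1 H2 H3 H4; case: (X a b) => x y /= H1 H2 H3 H4.
rewrite !ler_norml; split; apply/andP; split; lra.
Qed.

Lemma Omega_bounded : exists2 B : R, 0 <= B & forall X, Omega E X -> forall a b,
  `|complex.Re (X a b)| <= B /\ `|complex.Im (X a b)| <= B.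
Proof.
have /choice[B hB] : forall a, bounded_at (delta_mx a 0).
  move=> a; have [c ->] := delta_span a.
  by do 2!apply: bounded_at_sum => ?; apply: bounded_atZ; exact: bounded_at_w.
(* The form at an actual strategy shows that the upper bounds [B a] are nonnegative. *)
have [X0 OX0] := Omega_nonempty.
have B0 a : 0 <= B a.
  by apply: le_trans (hB a _ OX0); apply: psd_qform_Re OX0.1.
have Bsum a : B a <= \sum_a B a by rewrite (bigD1 a)//= lerDl sumr_ge0.
exists (\sum_a B a + \sum_a B a) => [|X OX a b].
  by rewrite addr_ge0// sumr_ge0.
have [h1 h2] := psd_entry a b OX.1.
have h a' : complex.Re (X a' a') <= \sum_a B a.
  by apply: le_trans (Bsum a'); rewrite -qform_delta; exact: hB.
by split; [apply: le_trans h1 _|apply: le_trans h2 _]; exact: lerD.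
Qed.

End StrategySet.

(** * Profiles as real vectors: compactness, convexity and continuity *)

Section Profiles.
Variables (R : realType) (N d n : nat) (E : 'I_d -> 'M[R[i]]_n).
Hypothesis Ebasis : is_basis E.
Local Notation C := (R[i]).
Local Notation index := ('I_N * 'I_d * 'I_d * bool)%type.

(** Real coordinates, with the boolean selecting the imaginary part, place the profiles in a
    finite-dimensional real normed space. *)
Definition profile (z : 'rV[R]_#|{: index}|) (k : 'I_N) : 'M[C]_d :=
  \matrix_(a, b) Complex (z 0 (enum_rank (k, a, b, false)))
                         (z 0 (enum_rank (k, a, b, true))).

Lemma profile_linear (t : R) x y k :
  profile (t *: x + y) k = t%:C%C *: profile x k + profile y k.
Proof.
apply/matrixP => a b; rewrite !mxE; apply/eqP; rewrite eq_complex /=.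
by apply/andP; split; apply/eqP; ring.
Qed.

Lemma profile_surj (chi : 'I_N -> 'M[C]_d) : exists z, forall k, profile z k = chi k.
Proof.
exists (\row_j let: (k, a, b, im) := enum_val j in
  if im then complex.Im (chi k a b) else complex.Re (chi k a b)) => k.
by apply/matrixP => a b; rewrite !mxE !enum_rankK; case: (chi k a b).
Qed.

Lemma profile_ccontinuous k a b : ccontinuous (fun z => profile z k a b).
Proof.
split; (under [X in continuous X]funext do rewrite mxE/=); exact: coord_continuous.
Qed.

Definition profiles := [set z | forall k, Omega E (profile z k)].

Lemma profiles_closed : closed profiles.
Proof.
pose herm k := [set z | forall a b,
  dag (profile z k) a b - profile z k a b = 0].
pose pos k := [set z | forall v, 0 <= qform (profile z k) v v].
pose F k z := \sum_(a < d) \sum_(b < d)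
  (profile z k a b)^* *: (dag (E a) *m E b).
pose tp k := [set z | forall i j, F k z i j - (1%:M : 'M[C]_n) i j = 0].
have -> : profiles = [set z | forall k, (herm k `&` pos k `&` tp k) z].
  apply/seteqP; split => z Oz k.
    have [[zh zp] zE] := Oz k; split; [split|] => //.
    - by move=> a b; rewrite zh subrr.
    - by move=> i j; rewrite /F zE subrr.
  have [[zh zp] zE] := Oz k; split; [split|] => //.
  - by apply/matrixP => a b; apply/eqP; rewrite -subr_eq0 zh.
  - by apply/matrixP => i j; apply/eqP; rewrite -subr_eq0 -/(F k z) zE.
apply: closed_forall => k; apply: closedI; first apply: closedI.
- do 2!apply: closed_forall => ?; apply: closed_ceq0; apply: ccontinuousD.
    under [X in ccontinuous X]funext do rewrite dagE.
    by apply: ccontinuous_conj; exact: profile_ccontinuous.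
  under [X in ccontinuous X]funext do rewrite -mulN1r.
  by apply: ccontinuousM; [exact: ccontinuous_cst|exact: profile_ccontinuous].
- apply: closed_forall => v; apply: closed_cge0.
  under [X in ccontinuous X]funext do rewrite qformE.
  do 2!apply: ccontinuous_sum => ?.
  apply: ccontinuousM; last exact: ccontinuous_cst.
  by apply: ccontinuousM; [exact: ccontinuous_cst|exact: profile_ccontinuous].
do 2!apply: closed_forall => ?; apply: closed_ceq0; apply: ccontinuousD.
  under [X in ccontinuous X]funext do rewrite summxE.
  apply: ccontinuous_sum => a.
  under [X in ccontinuous X]funext do rewrite summxE.
  apply: ccontinuous_sum => b.
  under [X in ccontinuous X]funext do rewrite mxE.
  apply: ccontinuousM; last exact: ccontinuous_cst.
  by apply: ccontinuous_conj; exact: profile_ccontinuous.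
exact: ccontinuous_cst.
Qed.

Lemma profiles_compact : compact profiles.
Proof.
apply: bounded_closed_compact; last exact: profiles_closed.
have [B B0 hB] := Omega_bounded Ebasis.
exists B; split; first exact: num_real.
move=> M BM z Kz; rewrite /= /Num.norm/= mx_normrE.
have M0 : 0 <= M by apply: le_trans B0 _; exact: ltW.
apply/bigmax_leP; split => // -[i j] _ /=; rewrite ord1 -[j]enum_valK.
case: (enum_val j) => [[[k a] b] im].
have [h1 h2] := hB _ (Kz k) a b.
have : `|z 0 (enum_rank (k, a, b, im))| <= B.
  by move: h1 h2; rewrite !mxE; case: im.
by move=> /le_trans; apply; exact: ltW.
Qed.

Lemma profiles_convex : convex_pred profiles.
Proof.
move=> t x y t01 Kx Ky k; rewrite -[_ *: y]addr0 !profile_linear.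
rewrite (_ : profile 0 k = 0); last by apply/matrixP => a b; rewrite !mxE.
by rewrite addr0; apply: Omega_convex.
Qed.

Lemma profiles_nonempty : profiles !=set0.
Proof.
have [X OX] := Omega_nonempty Ebasis.
have [z zX] := profile_surj (fun=> X).
by exists z => k; rewrite zX.
Qed.

Lemma payoff_ccontinuous (T : topologicalType) (rho Rk : 'M[C]_(cdim N n))
    (f : T -> 'I_N -> 'M[C]_d) :
  (forall k a b, ccontinuous (fun x => f x k a b)) ->
  ccontinuous (fun x => payoff E rho Rk (f x)).
Proof.
move=> fc; do 2!apply: ccontinuous_sum => ?.
apply: ccontinuousM; last exact: ccontinuous_cst.
by apply: ccontinuous_prod.
Qed.

End Profiles.

(** * Equilibria of the quantum game from the variational inequality *)

Theorem theorem1 (R : realType) (N q L : nat)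
  (E : 'I_(4 ^ q) -> 'M[R[i]]_(2 ^ q))
  (rho : 'M[R[i]]_(cdim N (2 ^ q)))
  (M : 'I_L -> 'M[R[i]]_(cdim N (2 ^ q)))
  (a : 'I_N -> 'I_L -> R) :
  is_basis E -> density rho -> povm M ->
  exists chi : 'I_N -> 'M[R[i]]_(4 ^ q),
    (forall k, Omega E (chi k)) /\
    forall (k : 'I_N) (chi' : 'M[R[i]]_(4 ^ q)), Omega E chi' ->
      payoff E rho (Rop M (a k)) (upd chi k chi')
        <= payoff E rho (Rop M (a k)) (upd chi k (chi k)).
Proof.
move=> Ebasis [[rho_herm _] _] _.
pose P k := payoff E rho (Rop M (a k)).
(* Taking real parts makes [g] real-valued and loses nothing, since payoffs at profiles of
   strategies are real. *)
pose g x y := \sum_k complex.Re (P k (upd (profile x) k (profile y k))).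
have g_linear x : scalar (g x).
  move=> t y z; rewrite /g mulr_sumr -big_split; apply: eq_bigr => k _ /=.
  by rewrite /P profile_linear payoff_upd_linear ReD ReM_real.
(* Letting both arguments vary covers a fixed [y] as well as the diagonal. *)
have g_cont (f h : 'rV[R]_#|{: 'I_N * 'I_(4 ^ q) * 'I_(4 ^ q) * bool}| -> _) :
    (forall k i j, ccontinuous (fun x => profile (f x) k i j)) ->
    (forall k i j, ccontinuous (fun x => profile (h x) k i j)) ->
    continuous (fun x => g (f x) (h x)).
  move=> fc hc; have : ccontinuous (fun x =>
      \sum_k P k (upd (profile (f x)) k (profile (h x) k))).
    apply: ccontinuous_sum => k; apply: payoff_ccontinuous => j i l.
    by rewrite /upd; case: (j == k).
  case=> + _; rewrite [X in continuous X -> _](_ : _ = fun x => g (f x) (h x))//.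
  apply/funext => x; rewrite /g; by elim/big_rec2: _ => // k u v _ <-; rewrite ReD.
have g_contl y : continuous (g ^~ y).
  apply: (g_cont id (fun=> y)) => k i j; first exact: profile_ccontinuous.
  exact: ccontinuous_cst.
have g_contd : continuous (fun x => g x x).
  by apply: (g_cont id id) => k i j; exact: profile_ccontinuous.
have [x Kx xP] := variational_inequality (profiles_compact Ebasis)
  (@profiles_convex _ _ _ _ E) g_linear g_contl g_contd (profiles_nonempty N Ebasis).
exists (profile x); split=> // k chi' Ochi'.
(* The test profile deviates from [x] for player [k] only. *)
have [y yE] := profile_surj (upd (profile x) k chi').
have Ky : profiles E y.
  by move=> j; rewrite yE /upd; case: eqP => // _; exact: Kx.
have P_real X : Omega E X -> complex.Im (P k (upd (profile x) k X)) = 0.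
  move=> OX; apply: Im_eq0_conj; apply: payoff_conj; [exact: rho_herm|exact: dag_Rop|].
  by move=> j; rewrite /upd; case: eqP => // _; [case: OX => -[]|case: (Kx j) => -[]].
rewrite lecE !P_real// eqxx /=.
(* The summands of the other players agree on both sides and cancel. *)
have := xP y Ky; rewrite /g (bigD1 k)//= [X in _ <= X](bigD1 k)//= !yE.
have -> : upd (profile x) k chi' k = chi' by rewrite /upd eqxx.
rewrite (eq_bigr (fun j => complex.Re (P j (upd (profile x) j (profile x j))))).
  by rewrite lerD2r.
by move=> j /negbTE jk; rewrite yE {2}/upd jk.
Qed.
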